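(* Fix $\alpha\in(0,1)$. Consider a Pandora's box instance with $n$ boxes, where box $i$ contains an integrable real-valued random prize $X_i$ with known distribution (the $X_i$ mutually independent) and has a deterministic inspection cost $c_i>0$. An adaptive policy $\pi$ opens boxes one at a time, observing the prize of each opened box, and eventually stops and selects exactly one opened box; write $\mathbb{I}_i\in\{0,1\}$ for the indicator that box $i$ is opened and $\mathbb{A}_i\in\{0,1\}$ for the indicator that box $i$ is selected, so that almost surely $\mathbb{A}_i\le \mathbb{I}_i$ and $\sum_i \mathbb{A}_i=1$. The objective of the policy is \[ \mathrm{CVaR}_\alpha\Big(\sum_{i=1}^n \mathbb{A}_i X_i\Big) - \mathbb{E}\Big[\sum_{i=1}^n \mathbb{I}_i c_i\Big], \] to be maximized over all adaptive policies. For $t\in\mathbb{R}$, let $\sigma_i(t)$ be the unique real number satisfying $c_i=\mathbb{E}\big[\big(\tfrac1\alpha\min\{t,X_i\}-\sigma_i(t)\big)_+\big]$, and let $\kappa_i(t)=\min\{\tfrac1\alpha\min\{t,X_i\},\,\sigma_i(t)\}$. Suppose the function $t\mapsto \mathbb{E}[\max_{i\in[n]}\kappa_i(t)]-\tfrac{1-\alpha}{\alpha}t$ attains its maximum over $t\in\mathbb{R}$, and let $t^\star$ be a maximizer. Consider the policy that, at each round, opens the unopened box with the largest index $\sigma_i(t^\star)$, and stops as soon as the largest observed prize $x$ so far satisfies that $\tfrac1\alpha\min\{t^\star,x\}$ exceeds every remaining (unopened) index $\sigma_j(t^\star)$, and then selects an opened box with the largest observed prize. Then this policy is optimal for the objective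 above.
   Context: For a real integrable random variable $Z$ and $\alpha\in(0,1]$, the (lower-tail) Conditional Value-at-Risk is $\mathrm{CVaR}_\alpha(Z)=\sup_{\lambda\in\mathbb{R}}\{\lambda-\tfrac1\alpha\mathbb{E}[(\lambda-Z)_+]\}$, equivalently $\mathrm{CVaR}_\alpha(Z)=\tfrac1\alpha\int_0^\alpha Q_Z(u)\,du$ where $Q_Z(u)=\inf\{z:F_Z(z)\ge u\}$ and $F_Z$ is the cdf of $Z$; $(x)_+=\max\{x,0\}$. Opened boxes may be revisited: the selected box can be any previously opened box. *)

(* Defs.v *)
From HB Require Import structures.
From mathcomp Require Import all_boot all_order all_algebra.
From mathcomp Require Import all_classical all_reals all_analysis.

Set Implicit Arguments.
Unset Strict Implicit.
Unset Printing Implicit Defensive.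

Import Order.TTheory GRing.Theory Num.Theory.

Local Open Scope classical_set_scope.
Local Open Scope ring_scope.

Section probability_notions.
Context {R : realType} {d : measure_display} {T : measurableType d}.
Variable P : probability T R.

Definition cvar (alpha : R) (Z : T -> R) : \bar R :=
  ereal_sup (range (fun l : R =>
    (l%:E - (alpha^-1)%:E * 'E_P[fun w => Num.max (l - Z w)%R 0%R])%E)).

Definition mutually_independent (n : nat) (X : 'I_n -> T -> R) : Prop :=
  forall (J : {set 'I_n}) (B : 'I_n -> set R),
    (forall i, measurable (B i)) ->
    P (\bigcap_(i in [set` J]) (X i @^-1` B i)) =
    (\prod_(i in J) P (X i @^-1` B i))%E.

End probability_notions.

Section policies.
Context {R : realType} {n : nat}.

Variant action := Open of 'I_n | Select of 'I_n.

(* The opened boxes with their observed prizes, in order of opening. *)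
Definition history := seq ('I_n * R).

Definition opened (h : history) : seq 'I_n := unzip1 h.

(* U is the range of a private random seed, drawn independently of the prizes:
   policies may be randomized; those that ignore the seed are deterministic.
   Measurability is joint in the seed and the observed prizes, for each order
   s in which boxes may have been opened. *)
Record policy (d : measure_display) (U : measurableType d) := Policy {
  decide :> U -> history -> action ;
  decide_legal : forall u h,
    match decide u h with
    | Open i => i \notin opened h
    | Select j => j \in opened h
    end ;
  decide_measurable : forall (s : seq 'I_n) (a : action),
    measurable [set p : U * (size s).-tuple R | decide p.1 (zip s p.2) = a]
}.

(* [None] is never returned by [outcome] below for a legal policy: after n
   openings the (n+1)-st decision has to be a selection. *)
Fixpoint play (dec : history -> action) (x : 'I_n -> R) (k : nat)
    (h : history) : history * option 'I_n :=
  if k is k'.+1 then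
    match dec h with
    | Open i => play dec x k' (rcons h (i, x i))
    | Select j => (h, Some j)
    end
  else (h, None).

Definition outcome (dec : history -> action) (x : 'I_n -> R) :=
  play dec x n.+1 [::].

Definition is_opened dec x (i : 'I_n) : bool :=
  i \in opened (outcome dec x).1.

Definition is_selected dec x (i : 'I_n) : bool :=
  (outcome dec x).2 == Some i.

Context {d : measure_display} {T : measurableType d}.

Definition payoff {d'} {U : measurableType d'} (X : 'I_n -> T -> R)
    (pi : policy U) (p : U * T) : R :=
  \sum_(i < n) (is_selected (pi p.1) (X ^~ p.2) i)%:R * X i p.2.

Definition inspection_cost {d'} {U : measurableType d'} (X : 'I_n -> T -> R)
    (c : 'I_n -> R) (pi : policy U) (p : U * T) : R :=
  \sum_(i < n) (is_opened (pi p.1) (X ^~ p.2) i)%:R * c i.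

(* Q is the law of the seed, P the law of the prizes. *)
Definition objective (alpha : R) (P : probability T R) (X : 'I_n -> T -> R)
    (c : 'I_n -> R) {d'} {U : measurableType d'} (Q : probability U R)
    (pi : policy U) : \bar R :=
  (cvar (Q \x P) alpha (payoff X pi)
   - 'E_(Q \x P)[inspection_cost X c pi])%E.

End policies.

Arguments policy R n {d} U.

Section index_policy.
Context {R : realType} {d : measure_display} {T : measurableType d}.
Variables (P : probability T R) (alpha : R).

(* For integrable Y, c > 0 and alpha > 0 such an s exists and is unique; the
   default 0 of [xget] is then irrelevant. *)
Definition sigma (Y : T -> R) (c t : R) : R :=
  xget 0 [set s : R |
    'E_P[fun w => Num.max (alpha^-1 * Num.min t (Y w) - s)%R 0%R]%E = c%:E].

Definition kappa (Y : T -> R) (c t : R) (w : T) : R :=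
  Num.min (alpha^-1 * Num.min t (Y w)) (sigma Y c t).

(* The seed of the maximum is one of its terms, so this is a plain maximum. *)
Definition kappa_value (n : nat) (X : 'I_n.+1 -> T -> R) (c : 'I_n.+1 -> R)
    (t : R) : \bar R :=
  ('E_P[fun w => \big[Num.max/kappa (X ord0) (c ord0) t w]_(i < n.+1)
                    kappa (X i) (c i) t w]
   - ((1 - alpha) / alpha * t)%:E)%E.

Definition best_observed (n : nat) (h : @history R n) (j : 'I_n) (x : R) :=
  (j, x) \in h /\ forall j' x', (j', x') \in h -> x' <= x.

Definition stop_condition (n : nat) (idx : 'I_n -> R) (t : R)
    (h : @history R n) : Prop :=
  exists j x, best_observed h j x /\
    forall k, k \notin opened h -> idx k < alpha^-1 * Num.min t x.

(* Ties between indices or between prizes are broken arbitrarily, possibly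
   depending on the seed and on the history. *)
Definition is_index_policy (n : nat) (idx : 'I_n -> R) (t : R)
    {d'} {U : measurableType d'} (pi : policy R n U) : Prop :=
  forall u h,
    match pi u h with
    | Open i => ~ stop_condition idx t h /\
        i \notin opened h /\
        (forall j, j \notin opened h -> idx j <= idx i)
    | Select j => stop_condition idx t h /\ exists x, best_observed h j x
    end.

End index_policy.

(* Main.v *)
Require Import Defs.
From HB Require Import structures.
From mathcomp Require Import all_boot all_order all_algebra.
From mathcomp Require Import all_classical all_reals all_analysis.
From mathcomp Require Import measurable_realfun ring lra.

(** For each level [t], the variational formula turns the CVaR objective into
    the expectation of [min (t, Z) / alpha] minus costs, up to the constant
    [(1 - alpha) / alpha * t]: an ordinary Pandora problem with prizes
    [Y_i = min (t, X_i) / alpha].  Weitzman's amortization applies to it: box i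
    is opened without knowing its prize, and [c_i] is the expected excess of
    [Y_i] over the index [sigma_i], so each cost may be replaced by
    that excess.  Pointwise, the selected value minus the excesses of the opened
    boxes is then at most the largest [kappa_i = min (Y_i, sigma_i)], with
    equality for the index rule.  Hence every objective is at most the supremum
    over [t] of the kappa value, and the index policy at the maximizer [tstar]
    attains it, since its CVaR is at least the term at [t = tstar]. *)

Set Implicit Arguments.
Unset Strict Implicit.
Unset Printing Implicit Defensive.

Import Order.TTheory GRing.Theory Num.Theory.

Local Open Scope classical_set_scope.
Local Open Scope ring_scope.

(** * Plays of a policy *)

Section plays.
Context {R : realType} {n : nat}.
Implicit Types (dec : @history R n -> @action n) (x y : 'I_n -> R)
  (s : seq 'I_n) (i j : 'I_n) (k : nat).

(** For fixed prizes a history reached in a play is determined by its order of opening, so plays can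
    be studied as sequences of boxes. *)
Definition trace x s : @history R n := [seq (i, x i) | i <- s].

Definition legal dec := forall h,
  match dec h with Open i => i \notin opened h | Select j => j \in opened h end.

(** Stated through splittings of [s], so that the decision made when a given box was opened can be
    recovered afterwards. *)
Definition follows dec x s :=
  forall s1 i s2, s = s1 ++ i :: s2 -> dec (trace x s1) = Open i.

Lemma opened_trace x s : opened (trace x s) = s.
Proof. by rewrite /opened /unzip1 -map_comp map_id. Qed.

Lemma trace_rcons x s i : trace x (rcons s i) = rcons (trace x s) (i, x i).
Proof. exact: map_rcons. Qed.

Lemma mem_trace x s i : i \in s -> (i, x i) \in trace x s.
Proof. by move=> si; apply/mapP; exists i. Qed.

Lemma trace_mem x s i r : (i, r) \in trace x s -> i \in s /\ r = x i.
Proof. by case/mapP=> j js [-> ->]. Qed.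

Lemma eq_trace x y s : {in s, x =1 y} -> trace x s = trace y s.
Proof. by move=> xy; apply/eq_in_map => i /xy ->. Qed.

Lemma follows_nil dec x : follows dec x [::].
Proof. by move=> [|? ?] i s2. Qed.

Lemma follows_rcons dec x s i : follows dec x s -> dec (trace x s) = Open i ->
  follows dec x (rcons s i).
Proof.
move=> fs di s1 j s2; elim/last_ind: s2 => [|s2 l _].
  rewrite -cats1 => /eqP; rewrite !cats1 eqseq_rcons.
  by move=> /andP[/eqP <- /eqP <-].
rewrite -rcons_cons -rcons_cat => /eqP; rewrite eqseq_rcons => /andP[/eqP + _].
exact: fs.
Qed.

(** Opened boxes are distinct, so at most [n] openings occur; the bound [n < size s + k] leaves one
    round for the selection before the fuel runs out. *)
Lemma playP dec x k s : legal dec -> follows dec x s -> uniq s ->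
    (n < size s + k)%N ->
  exists s' j, [/\ play dec x k (trace x s) = (trace x s', Some j),
    follows dec x s', uniq s' & dec (trace x s') = Select j].
Proof.
move=> ldec; elim: k s => [|k IH] s fs us.
  rewrite addn0 ltnNge => /negP[]; rewrite -[leqRHS]card_ord.
  by rewrite -(card_uniqP us) max_card.
rewrite addnS /= => ns; case E : (dec (trace x s)) => [i|j].
  rewrite -trace_rcons; apply: IH => //.
  - exact: follows_rcons.
  - by have := ldec (trace x s); rewrite E opened_trace rcons_uniq us andbT.
  - by rewrite size_rcons.
by exists s, j.
Qed.

Lemma outcomeP dec x : legal dec ->
  exists s j, [/\ outcome dec x = (trace x s, Some j),
    follows dec x s, uniq s & dec (trace x s) = Select j].
Proof.
move=> ldec; apply: (@playP dec x n.+1 [::]) => //; exact: follows_nil.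
Qed.

Lemma sub_opened_play dec x k s :
  {subset s <= opened (play dec x k (trace x s)).1}.
Proof.
elim: k s => [|k IH] s i si /=; first by rewrite opened_trace.
case: (dec _) => [j|j]; last by rewrite opened_trace.
by rewrite -trace_rcons IH// mem_rcons inE si orbT.
Qed.

(** Until box [i] is opened its prize is absent from the history, so both plays make the same
    decisions; once opened, it stays opened in both. *)
Lemma opened_play_local dec x y i k s : (forall j, j != i -> x j = y j) ->
    i \notin s ->
  (i \in opened (play dec x k (trace x s)).1) =
  (i \in opened (play dec y k (trace y s)).1).
Proof.
move=> xy; elim: k s => [|k IH] s si /=; first by rewrite !opened_trace.
have trE : trace x s = trace y s.
  by apply: eq_trace => j js; rewrite xy//; apply: contraNneq si => <-.
rewrite -trE.
case E : (dec _) => [j|j]//.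
have [ji|ji] := eqVneq j i.
  rewrite -trace_rcons sub_opened_play ?mem_rcons ?inE ?ji ?eqxx//.
  by rewrite trE -trace_rcons sub_opened_play// mem_rcons inE eqxx.
by rewrite {2}trE -!trace_rcons IH// mem_rcons inE negb_or eq_sym ji.
Qed.

Lemma is_opened_local dec x y i : (forall j, j != i -> x j = y j) ->
  is_opened dec x i = is_opened dec y i.
Proof. by move=> xy; exact: (@opened_play_local dec x y i n.+1 [::]). Qed.

End plays.

(** * Pointwise amortization, and its equality case for the index rule *)

Section index_plays.
Context {R : realType} {n : nat}.
Variables (alpha t : R) (idx : 'I_n -> R) (x : 'I_n -> R).
Hypothesis alpha_gt0 : 0 < alpha.

Let v (i : 'I_n) : R := alpha^-1 * Num.min t (x i).

Let kap (i : 'I_n) : R := Num.min (v i) (idx i).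

Lemma le_capped (r r' : R) : r <= r' ->
  alpha^-1 * Num.min t r <= alpha^-1 * Num.min t r'.
Proof.
move=> rr'; apply: ler_wpM2l; first by rewrite invr_ge0 ltW.
by rewrite le_min ge_min lexx/= ge_min rr' orbT.
Qed.

Lemma sum_pred1 (j : 'I_n) (F : 'I_n -> R) :
  \sum_(i < n) (Some j == Some i)%:R * F i = F j.
Proof.
rewrite (bigD1 j)//= eqxx mul1r big1 ?addr0// => i ij.
rewrite (_ : (Some j == Some i) = false) ?mul0r//.
by apply/eqP => -[ji]; rewrite ji eqxx in ij.
Qed.

Lemma subr_excess (a b : R) : a - Num.max (a - b) 0 = Num.min a b.
Proof.
have [ab|/ltW ba] := leP a b; first by rewrite max_r ?subr0// subr_le0.
by rewrite max_l ?subr_ge0// subKr.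
Qed.

(* Weitzman's amortization: replacing each cost by the excess over the index,
   a policy can collect no more than the capped value of the selected box. *)
Lemma amortized_le dec : legal dec -> exists j,
  alpha^-1 * Num.min t (\sum_(i < n) (is_selected dec x i)%:R * x i)
  - \sum_(i < n) (is_opened dec x i)%:R * Num.max (v i - idx i) 0 <= kap j.
Proof.
move=> ldec; have [s [j [E fs us ds]]] := outcomeP x ldec.
exists j; rewrite /is_selected /is_opened E /= opened_trace sum_pred1.
rewrite /kap -(subr_excess (v j)) lerD2l lerN2 (bigD1 j)//=.
(* The selected box is opened, so its own excess is among those subtracted; the other excesses only
   lower the left-hand side. *)
have -> : j \in s by have := ldec (trace x s); rewrite ds opened_trace.
rewrite mul1r lerDl sumr_ge0// => i _.
by rewrite mulr_ge0// le_max lexx orbT.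
Qed.

Definition index_rule dec := forall h : @history R n,
  match dec h with
  | Open i => ~ stop_condition alpha idx t h /\ i \notin opened h /\
      (forall j, j \notin opened h -> idx j <= idx i)
  | Select j => stop_condition alpha idx t h /\ exists r, best_observed h j r
  end.

Lemma best_observed_ex (h : @history R n) : h != [::] ->
  exists i r, best_observed h i r.
Proof.
case: h => // -[a y] h _; elim: h a y => [|[b z] h IH] a y.
  exists a, y; split; first exact: mem_head.
  by move=> j r; rewrite inE => /eqP[_ ->].
have [i [r [mi bi]]] := IH b z.
have [ry|yr] := leP r y.
  exists a, y; split; first exact: mem_head.
  move=> j q; rewrite inE => /predU1P[[_ ->]//|/bi qr].
  exact: le_trans qr ry.
exists i, r; split; first by rewrite inE mi orbT.
by move=> j q; rewrite inE => /predU1P[[_ ->]|/bi//]; exact: ltW.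
Qed.

(** If an observed capped value exceeded [idx i], so would the best one; since [idx i] is the
    largest remaining index, the rule would have stopped instead of opening [i]. *)
Lemma open_dominates dec s i : index_rule dec -> dec (trace x s) = Open i ->
  (forall l, l \in s -> v l <= idx i) /\
  (forall l, l \notin s -> idx l <= idx i).
Proof.
move=> idec di; have := idec (trace x s); rewrite di opened_trace.
move=> [nstop [_ imax]]; split=> // l ls.
have [|b [r bb]] := @best_observed_ex (trace x s).
  by case: s ls {di nstop imax}.
rewrite leNgt; apply/negP => il; apply: nstop; exists b, r; split=> // k.
rewrite opened_trace => /imax ki; apply: le_lt_trans ki (lt_le_trans il _).
by apply: le_capped; case: bb => _ /(_ l); apply; exact: mem_trace.
Qed.

(** Converse of [amortized_le] for the index rule: no opened box but the selected [j] has a positive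
    excess, so exactly [kap j] is collected, and [kap j] is the largest of all. *)
Lemma amortized_index dec : legal dec -> index_rule dec -> forall i,
  kap i <= alpha^-1 * Num.min t (\sum_(i < n) (is_selected dec x i)%:R * x i)
  - \sum_(i < n) (is_opened dec x i)%:R * Num.max (v i - idx i) 0.
Proof.
move=> ldec idec; have [s [j [E fs us ds]]] := outcomeP x ldec.
rewrite /is_selected /is_opened E /= opened_trace sum_pred1.
have js : j \in s by have := ldec (trace x s); rewrite ds opened_trace.
have := idec (trace x s); rewrite ds => -[[b [r0 [[mb bb] stop]]] [r [mr br]]].
have rj : r = x j by have [] := trace_mem mr.
have xs_le l : l \in s -> v l <= v j.
  by move=> ls; apply: le_capped; rewrite -rj; apply: (br l); exact: mem_trace.
have stop_lt k : k \notin s -> idx k < v j.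
  move=> ks; have := stop k; rewrite opened_trace => /(_ ks) h.
  by apply: lt_le_trans h _; apply: le_capped; rewrite -rj; apply: br mb.
have prefix_dom s1 a s2 : s = s1 ++ a :: s2 ->
    (forall l, l \in s1 -> v l <= idx a) /\
    (forall l, l \notin s1 -> idx l <= idx a).
  by move=> sE; apply: open_dominates idec (fs _ _ _ sE).
(* an opened box whose value exceeds its index ends the search as the best *)
have excess0 i : i \in s -> i != j -> v i <= idx i.
  move=> si ij; rewrite leNgt; apply/negP => iv.
  case/splitPr sE : {1}s / si => [s1 s2].
  have [d1 d2] := prefix_dom _ _ _ sE.
  have : j \in s by [].
  (* If [j] was opened before [i], then [v i <= v j <= idx i]; if after, then
     [v i <= idx j <= idx i]. Both contradict [idx i < v i]. *)
  rewrite sE mem_cat inE eq_sym (negbTE ij)/= => /orP[js1|js2].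
    have := xs_le i; rewrite sE mem_cat mem_head orbT => /(_ isT) h.
    by have := le_lt_trans (le_trans h (d1 _ js1)) iv; rewrite ltxx.
  case/splitPr s2E : {1}s2 / js2 => [s3 s4].
  have [|d3 d4] := prefix_dom (s1 ++ i :: s3) j s4.
    by rewrite sE s2E -catA.
  have ij' : idx j <= idx i.
    apply: d2; move: us; rewrite sE s2E cat_uniq => /and3P[_ /hasPn h _].
    by apply: h; rewrite inE mem_cat mem_head !orbT.
  have := d3 i; rewrite mem_cat mem_head orbT => /(_ isT) vij.
  by have := le_lt_trans (le_trans vij ij') iv; rewrite ltxx.
have -> : \sum_(i < n) (i \in s)%:R * Num.max (v i - idx i) 0
    = Num.max (v j - idx j) 0.
  rewrite (bigD1 j)//= js mul1r big1 ?addr0// => i ij.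
  have [si|] := boolP (i \in s); last by rewrite mul0r.
  by rewrite mul1r max_r// subr_le0 excess0.
move=> i; rewrite -/(v j) subr_excess /kap.
case/splitPr sE : {1}s / js => [s1 s2].
have [d1 d2] := prefix_dom _ _ _ sE.
(* An unopened [i] has [idx i < v j] by stopping and [idx i <= idx j] from the time [j] was opened.
   An opened [i] has [v i <= v j], together with [v i <= idx j] if it precedes [j] and
   [idx i <= idx j] otherwise. *)
have [si|si] := boolP (i \in s); last first.
  apply: (@le_trans _ _ (idx i)); first by rewrite ge_min lexx orbT.
  rewrite le_min (ltW (stop_lt _ si)) d2//=.
  by apply: contraNN si; rewrite sE mem_cat => ->.
rewrite le_min ge_min xs_le//= ge_min.
have [is1|is1] := boolP (i \in s1); first by rewrite d1.
by rewrite d2// orbT.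
Qed.

End index_plays.

(** * Measurability and independence *)

Section independence_integral.
Local Open Scope ereal_scope.
Context d d' (W : measurableType d) (T : measurableType d') (R : realType).
Variables (mu : probability W R) (P : probability T R).

(** By the independence hypothesis, the push-forward along [Z] of [mu] restricted to [D] is [mu D]
    times the law of [X]; both sides integrate [g] against this measure. *)
Lemma ge0_integral_indep (D : set W) (Z : W -> R) (X : T -> R) (g : R -> R) :
  measurable D -> measurable_fun setT Z -> measurable_fun setT X ->
  measurable_fun setT g -> (forall r, 0 <= g r)%R ->
  (forall A : set R, measurable A ->
    mu (D `&` Z @^-1` A) = mu D * P (X @^-1` A)) ->
  \int[mu]_(w in D) (g (Z w))%:E = mu D * \int[P]_w (g (X w))%:E.
Proof.
move=> mD mZ mX mg g0 ind.
pose X' : {mfun T >-> R} := HB.pack X (isMeasurableFun.Build _ _ _ _ X mX).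
have mEg : measurable_fun [set: R] (fun r => (g r)%:E).
  exact/measurable_EFinP.
have k0 : (0 <= fine (mu D))%R by exact: fine_ge0.
pose k := NngNum k0.
transitivity (\int[mrestr mu mD]_w (g (Z w))%:E).
  rewrite [RHS](ge0_negligible_integral (measurableC mD))//=; last 3 first.
  - exact: measurableT_comp mEg mZ.
  - by move=> w _; rewrite lee_fin.
  - by rewrite /mrestr setICl measure0.
  rewrite setTD setCK; apply: eq_measure_integral => A mA AD.
  by rewrite /= /mrestr setIidl.
have g0' : {in setT, forall r, 0 <= (g r)%:E} by move=> r _; rewrite lee_fin.
rewrite -[setT in LHS](preimage_setT Z).
rewrite -(ge0_integral_pushforward mZ (mrestr mu mD) measurableT mEg g0').
rewrite (eq_measure_integral (mscale k (distribution P X'))); last first.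
  move=> A mA _; rewrite /= /pushforward /mrestr/= setIC ind//.
  by rewrite -[RHS]/(_ * _) fineK// fin_num_measure.
rewrite ge0_integral_mscale//; last by move=> r _; rewrite lee_fin.
congr (_ * _).
  by rewrite /= fineK// fin_num_measure.
exact: (@ge0_integral_distribution _ _ _ _ _ P X').
Qed.

End independence_integral.

Section tuple_rectangles.
Context d (U : measurableType d) (R : realType) (n : nat).

(** A generating pi-system on which mutual independence of the prizes can be applied directly. *)
Definition rectangles : set (set (U * n.-tuple R)) :=
  [set C | exists A (B : 'I_n -> set R),
    [/\ measurable A, forall i, measurable (B i) &
        C = A `*` [set x | forall i, B i (tnth x i)]]].

Lemma measurable_box (B : 'I_n -> set R) : (forall i, measurable (B i)) ->
  measurable [set x : n.-tuple R | forall i, B i (tnth x i)].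
Proof.
move=> mB; rewrite [X in measurable X](_ : _ =
    \bigcap_(i in [set: 'I_n]) ((@tnth _ R ^~ i) @^-1` B i)); last first.
  by apply/seteqP; split => x /= h i; [move=> _|]; exact: h.
apply: fin_bigcap_measurable; first exact: finite_finset.
by move=> i _; rewrite -[X in measurable X]setTI; exact: measurable_tnth.
Qed.

Lemma measurable_rectangles C : rectangles C -> measurable C.
Proof.
move=> [A [B [mA mB ->]]]; apply: measurableX => //; exact: measurable_box.
Qed.

Lemma setI_closed_rectangles : setI_closed rectangles.
Proof.
move=> _ _ [A [B [mA mB ->]]] [A' [B' [mA' mB' ->]]].
exists (A `&` A'), (fun i => B i `&` B' i); split.
- exact: measurableI.
- by move=> i; exact: measurableI.
- apply/seteqP; split => -[u x] /=.
    by move=> [[? h] [? h']]; split=> // i; split.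
  by move=> [[? ?] h]; split; split=> // i; have [] := h i.
Qed.

(** The tuple sets whose preimage under [snd] is generated by rectangles form a sigma-algebra, and
    it contains the coordinate cylinders: these are rectangles with all sides but one full. *)
Lemma rectanglesE : @measurable _ (U * n.-tuple R)%type = <<s rectangles >>.
Proof.
apply/seteqP; split; last first.
  apply: smallest_sub; first exact: sigma_algebra_measurable.
  exact: measurable_rectangles.
have msR : sigma_algebra setT <<s rectangles >>.
  exact: smallest_sigma_algebra.
apply: smallest_sub => // C [[A mA <-]|[B mB <-]].
  apply: sub_sigma_algebra; exists A, (fun=> setT); split=> //.
  by apply/seteqP; split => -[u x] /= [].
rewrite setTI.
have m2 : sigma_algebra setT (image_set_system setT (@snd U (n.-tuple R))
    <<s rectangles >>) by exact: sigma_algebra_image.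
suff /(_ _ mB) : @measurable _ (n.-tuple R) `<=`
    image_set_system setT (@snd U _) <<s rectangles >>.
  by rewrite /image_set_system/= setTI.
apply: smallest_sub => // B0; rewrite -bigcup_seq/= => -[i _ [A mA <-]].
rewrite /image_set_system/= !setTI; apply: sub_sigma_algebra.
exists setT, (fun j => if j == i then A else setT).
split=> //; first by move=> j; case: ifP.
apply/seteqP; split => -[u x] /=.
  by move=> Ax; split=> // j; case: eqP => // ->.
by move=> [_ /(_ i)]; rewrite eqxx.
Qed.

End tuple_rectangles.

Section independence_generator.
Local Open Scope ereal_scope.
Context d d' (W : measurableType d) (V : measurableType d') (R : realType).
Variables (mu : probability W R) (G : set (set V)) (H : W -> V) (E : set W).

(** A Dynkin argument: the sets satisfying the product formula are stable under complements and
    countable disjoint unions, so the pi-system [G] suffices. *)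
Lemma indep_preimage_generated : @measurable _ V = <<s G >> -> setI_closed G ->
  measurable_fun setT H -> measurable E ->
  (forall C, G C -> mu (H @^-1` C `&` E) = mu (H @^-1` C) * mu E) ->
  forall C, measurable C -> mu (H @^-1` C `&` E) = mu (H @^-1` C) * mu E.
Proof.
move=> GE GI mH mE indG C; rewrite GE.
have mHC S : measurable S -> measurable (H @^-1` S).
  by move=> mS; rewrite -[X in measurable X]setTI; exact: mH.
apply: (dynkin_induction (P := fun C => mu (H @^-1` C `&` E) =
  mu (H @^-1` C) * mu E) GE GI).
- by rewrite preimage_setT setTI [X in _ = X * _]probability_setT mul1e.
- exact: indG.
- move=> S mS indS; rewrite preimage_setC setIC -setDE measureD//; last first.
  + by rewrite (le_lt_trans (probability_le1 _ _))// ltry.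
  + exact: mHC.
  rewrite setIC [X in mu E - X]indS.
  rewrite [X in _ = X * _]probability_setC; last exact: mHC.
  rewrite -(fineK (fin_num_measure mu _ mE)).
  rewrite -(fineK (fin_num_measure mu _ (mHC _ mS))).
  by rewrite -EFinM -!EFinB -EFinM mulrBl mul1r.
- move=> F mF tF indF; rewrite preimage_bigcup setI_bigcupl.
  have tHF : trivIset setT (fun k => H @^-1` F k).
    by move=> a b _ _ [w [? ?]]; apply: (tF a b) => //; exists (H w).
  rewrite !measure_bigcup//=; last 3 first.
  + by move=> k _; exact: mHC.
  + by move=> k _; apply: measurableI => //; exact: mHC.
  + by apply: trivIset_setIr.
  rewrite (eq_eseriesr (fun k _ => indF k)).
  rewrite -(fineK (fin_num_measure mu _ mE)).
  under eq_eseriesr do rewrite muleC.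
  rewrite nneseriesZl; last by move=> k _.
  by rewrite muleC.
Qed.

End independence_generator.

(** * Measurability of the events that a box is opened or selected *)

Section policy_measurability.
Context {R : realType} {n : nat} d (U : measurableType d).
Variable pi : policy R n U.

Lemma policy_legal u : legal (pi u).
Proof. by move=> h; exact: (decide_legal pi u h). Qed.

Lemma measurable_constant_set d1 (W : measurableType d1) (S : Prop) :
  measurable [set _ : W | S].
Proof.
by have [h|h] := pselect S;
  [rewrite (_ : [set _ | _] = setT)|rewrite (_ : [set _ | _] = set0)] => //;
  apply/seteqP; split.
Qed.

Lemma measurable_decision (s : seq 'I_n) (a : @action n) :
  measurable [set p : U * n.-tuple R | pi p.1 (trace (tnth p.2) s) = a].
Proof.
pose G (p : U * n.-tuple R) : U * (size s).-tuple R :=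
  (p.1, [tuple of [seq tnth p.2 i | i <- in_tuple s]]).
have mG : measurable_fun setT G.
  apply: measurable_fun_pair => //; apply/measurable_fun_tnthP => i /=.
  rewrite (_ : _ \o _ = (@tnth _ R ^~ (tnth (in_tuple s) i)) \o snd).
    by apply: measurableT_comp => //; exact: measurable_tnth.
  by apply/funext => p /=; rewrite tnth_map.
have := mG measurableT _ (@decide_measurable _ _ _ _ pi s a); rewrite setTI.
by congr measurable; apply/seteqP; split=> p /=; rewrite /trace -zip_map map_id.
Qed.

(** Induction on the fuel: the event splits over the finitely many next actions, and after an
    opening the rest is the same kind of event for a longer [s]. The set [S] is arbitrary, to serve
    both opening and selection. *)
Lemma measurable_play k s (S : set (seq 'I_n * option 'I_n)) :
  measurable [set p : U * n.-tuple R |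
    let r := play (pi p.1) (tnth p.2) k (trace (tnth p.2) s) in
    S (opened r.1, r.2)].
Proof.
elim: k s => [|k IH] s /=.
  under eq_set do rewrite opened_trace; exact: measurable_constant_set.
rewrite [X in measurable X](_ : _ =
  \bigcup_(i in [set: 'I_n])
    ([set p | pi p.1 (trace (tnth p.2) s) = Open i] `&`
     [set p | let r := play (pi p.1) (tnth p.2) k (trace (tnth p.2) (rcons s i))
              in S (opened r.1, r.2)]) `|`
  \bigcup_(j in [set: 'I_n])
    ([set p | pi p.1 (trace (tnth p.2) s) = Select j] `&`
     [set _ | S (s, Some j)])).
  apply: measurableU; apply: fin_bigcup_measurable; rewrite ?finite_finset//;
    move=> i _; apply: measurableI.
  - exact: measurable_decision.
  - exact: IH.
  - exact: measurable_decision.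
  - exact: measurable_constant_set.
apply/seteqP; split => p /=.
  case E : (pi _ _) => [i|j] /=.
    by rewrite -trace_rcons => h; left; exists i.
  by rewrite opened_trace => h; right; exists j.
case=> -[i _ /= [-> ]]; first by rewrite -trace_rcons.
by rewrite opened_trace.
Qed.

Lemma measurable_is_opened i :
  measurable [set p : U * n.-tuple R | is_opened (pi p.1) (tnth p.2) i].
Proof.
exact: (measurable_play n.+1 [::] [set r : seq _ * option _ | i \in r.1]).
Qed.

Lemma measurable_is_selected i :
  measurable [set p : U * n.-tuple R | is_selected (pi p.1) (tnth p.2) i].
Proof. exact: (measurable_play n.+1 [::] [set r | r.2 == Some i]). Qed.

End policy_measurability.

(** * Integrating out the seed *)

Section second_marginal.
Context d d' (U : measurableType d) (T : measurableType d') (R : realType).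
Variables (Q : probability U R) (P : probability T R).

Lemma snd_preimage_prod (A : set T) : measurable A ->
  ((Q \x P) (snd @^-1` A) = P A)%E.
Proof.
move=> mA; rewrite (_ : snd @^-1` A = setT `*` A); last first.
  by apply/seteqP; split=> -[u w] //= [].
by rewrite product_measure1E// [X in (X * _)%E]probability_setT mul1e.
Qed.

Lemma ge0_integral_snd (f : T -> \bar R) : measurable_fun setT f ->
  (forall w, 0 <= f w)%E ->
  (\int[Q \x P]_p f p.2 = \int[P]_w f w)%E.
Proof.
move=> mf f0.
have := @ge0_integral_pushforward _ _ _ _ R (@snd U T) measurable_snd
  (Q \x P)%E setT f measurableT mf (fun w _ => f0 w).
rewrite preimage_setT => <-; apply: eq_measure_integral => A mA _.
exact: snd_preimage_prod.
Qed.

Lemma integrable_snd (f : T -> R) : P.-integrable setT (EFin \o f) ->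
  (Q \x P)%E.-integrable setT (EFin \o (fun p => f p.2)).
Proof.
move=> /integrableP[mf fi]; apply/integrableP; split.
  exact: (measurableT_comp mf measurable_snd).
rewrite (ge0_integral_snd (f := fun w => `|(EFin \o f) w|%E))//.
exact: measurableT_comp.
Qed.

Lemma Rintegral_snd (f : T -> R) : P.-integrable setT (EFin \o f) ->
  \int[(Q \x P)%E]_p f p.2 = \int[P]_w f w.
Proof.
move=> fi; rewrite /Rintegral; congr fine.
have := @integral_pushforward _ _ _ _ R (@snd U T) measurable_snd
  (Q \x P)%E setT (EFin \o f) (measurable_int _ fi).
rewrite preimage_setT => /(_ (integrable_snd fi) measurableT) <-.
by apply: eq_measure_integral => A mA _; exact: snd_preimage_prod.
Qed.

End second_marginal.

(** * Independence of the opening of a box from its prize *)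

Section prizes.
Context {R : realType} {n : nat} d d' (U : measurableType d)
  (T : measurableType d').
Variables (P : probability T R) (Q : probability U R).
Variables (X : 'I_n -> {RV P >-> R}) (pi : policy R n U).

Lemma measurable_seed_prizes (Y : 'I_n -> T -> R) :
  (forall i, measurable_fun setT (Y i)) ->
  measurable_fun setT (fun p : U * T => (p.1, [tuple Y i p.2 | i < n])).
Proof.
move=> mY; apply: measurable_fun_pair => //; apply/measurable_fun_tnthP => i /=.
rewrite (_ : _ \o _ = Y i \o snd); first exact: measurableT_comp.
by apply/funext => p /=; rewrite tnth_mktuple.
Qed.

Lemma measurable_opened_set i :
  measurable [set p : U * T | is_opened (pi p.1) (X ^~ p.2) i].
Proof.
have := @measurable_seed_prizes (fun i => X i) (fun i => measurable_funPT _)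
  measurableT _ (measurable_is_opened pi i).
rewrite setTI; congr measurable; apply/seteqP; split=> p /=;
  by under [tnth _]funext do rewrite tnth_mktuple.
Qed.

Lemma measurable_selected_set i :
  measurable [set p : U * T | is_selected (pi p.1) (X ^~ p.2) i].
Proof.
have := @measurable_seed_prizes (fun i => X i) (fun i => measurable_funPT _)
  measurableT _ (measurable_is_selected pi i).
rewrite setTI; congr measurable; apply/seteqP; split=> p /=;
  by under [tnth _]funext do rewrite tnth_mktuple.
Qed.

Local Open Scope ereal_scope.

Hypothesis indep : mutually_independent P (fun i => X i : T -> R).

(** Replacing the prize of [i] by 0 does not change whether [i] is opened, so this event depends
    only on the seed and the other prizes, which are independent of [X i]. *)
Lemma opened_indep_prize i (A : set R) : measurable A ->
  (Q \x P) ([set p : U * T | is_opened (pi p.1) (X ^~ p.2) i] `&`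
            (X i \o snd) @^-1` A) =
  (Q \x P) [set p : U * T | is_opened (pi p.1) (X ^~ p.2) i] *
  P (X i @^-1` A).
Proof.
move=> mA.
pose Y j : T -> R := if j == i then cst 0%R else X j.
have mY j : measurable_fun setT (Y j) by rewrite /Y; case: ifP.
pose H (p : U * T) := (p.1, [tuple Y j p.2 | j < n]).
have mXA : measurable (X i @^-1` A).
  by rewrite -[X in measurable X]setTI; exact: measurable_funPT.
have -> : [set p : U * T | is_opened (pi p.1) (X ^~ p.2) i] =
    H @^-1` [set q | is_opened (pi q.1) (tnth q.2) i].
  apply: eq_set => p /=; congr is_true; apply: is_opened_local => j ji.
  by rewrite tnth_mktuple /Y (negbTE ji).
rewrite -(snd_preimage_prod Q P mXA).
apply: (@indep_preimage_generated _ _ _ _ _ (Q \x P) _ _ _ (rectanglesE U R n)).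
- exact: setI_closed_rectangles.
- exact: measurable_seed_prizes.
- have := @measurable_snd _ _ U T measurableT _ mXA; rewrite setTI; exact.
- move=> _ [B0 [B [mB0 mB ->]]].
  rewrite [X in _ = _ * X](snd_preimage_prod Q P mXA).
  (* Coordinate [i] of [H] is constantly 0, so a rectangle whose [i]-th side misses 0 has empty
     preimage. *)
  have [Bi0|Bi0] := pselect (B i 0%R); last first.
    have -> : H @^-1` (B0 `*` [set x | forall j, B j (tnth x j)]) = set0.
      apply/seteqP; split=> // p /= [_ /(_ i)].
      by rewrite tnth_mktuple /Y eqxx.
    by rewrite set0I measure0 mul0e.
  have -> : H @^-1` (B0 `*` [set x | forall j, B j (tnth x j)]) =
      B0 `*` \bigcap_(j in [set` [set~ i]%SET]) (X j @^-1` B j).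
    apply/seteqP; split=> -[u w] /= [B0u h]; split=> // j.
      rewrite /= !inE => ji.
      by have := h j; rewrite tnth_mktuple /Y (negbTE ji).
    rewrite tnth_mktuple /Y; case: eqVneq => [->//|ji].
    by apply: h; rewrite /= !inE.
  (* With [A] as the [i]-th side, both conditions merge into one intersection over all boxes; its
     product formula has exactly one factor more than the one over the boxes other than [i]. *)
  pose B' j := if j == i then A else B j.
  have -> : (B0 `*` \bigcap_(j in [set` [set~ i]%SET]) (X j @^-1` B j)) `&`
      snd @^-1` (X i @^-1` A) =
      B0 `*` \bigcap_(j in [set` [set: 'I_n]%SET]) (X j @^-1` B' j).
    apply/seteqP; split=> -[u w] /=.
      move=> [[B0u h] Ai]; split=> // j _; rewrite /B' /=.
      by case: eqVneq => [->//|ji]; apply: h; rewrite /= !inE.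
    move=> [B0u h]; split; [split=> // j|].
      rewrite /= !inE => ji.
      by have := h j; rewrite /B' /= !inE (negbTE ji); exact.
    by have := h i; rewrite /B' /= !inE eqxx; exact.
  have mcap (J : {set 'I_n}) (C : 'I_n -> set R) :
      (forall j, measurable (C j)) ->
      measurable (\bigcap_(j in [set` J]) (X j @^-1` C j)).
    move=> mC; apply: fin_bigcap_measurable; first exact: finite_finset.
    by move=> j _; rewrite -[X in measurable X]setTI; exact: measurable_funPT.
  have mB' j : measurable (B' j) by rewrite /B'; case: ifP.
  rewrite [LHS]product_measure1E//; last exact: mcap.
  rewrite [X in _ = X * _]product_measure1E//; last exact: mcap.
  rewrite [X in _ * X = _](indep _ mB') [X in _ = _ * X * _](indep _ mB).
  rewrite -muleA; congr (_ * _).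
  rewrite (bigD1 i) ?inE//= /B' eqxx muleC; congr (_ * _).
  by apply: eq_big => [j|j /andP[_ /negbTE ->]//]; rewrite !inE.
- exact: measurable_is_opened.
Qed.

End prizes.

(** * Integrals and the index equation *)

Section real_integrals.
Context d (W : measurableType d) (R : realType) (mu : probability W R).

Lemma integrable_dominated (f g : W -> R) : measurable_fun setT f ->
  mu.-integrable setT (EFin \o g) -> (forall w, `|f w| <= g w) ->
  mu.-integrable setT (EFin \o f).
Proof.
move=> mf ig fg; apply: le_integrable ig => //.
  exact/measurable_EFinP.
by move=> w _ /=; rewrite lee_fin (le_trans (fg w))// ler_norm.
Qed.

Lemma integrableD_EFin (f g : W -> R) : mu.-integrable setT (EFin \o f) ->
  mu.-integrable setT (EFin \o g) ->
  mu.-integrable setT (EFin \o (fun w => f w + g w)).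
Proof. by move=> fi gi; exact: (integrableD measurableT fi gi). Qed.

Lemma integrableB_EFin (f g : W -> R) : mu.-integrable setT (EFin \o f) ->
  mu.-integrable setT (EFin \o g) ->
  mu.-integrable setT (EFin \o (fun w => f w - g w)).
Proof. by move=> fi gi; exact: (integrableB measurableT fi gi). Qed.

Lemma integrableZl_EFin (k : R) (f : W -> R) :
  mu.-integrable setT (EFin \o f) ->
  mu.-integrable setT (EFin \o (fun w => k * f w)).
Proof. by move=> fi; exact: (integrableZl measurableT k fi). Qed.

Lemma integrable_cst_EFin (k : R) : mu.-integrable setT (EFin \o (fun=> k)).
Proof. exact: finite_measure_integrable_cst. Qed.

Lemma integrable_sum_EFin n (f : 'I_n -> W -> R) :
  (forall i, mu.-integrable setT (EFin \o f i)) ->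
  mu.-integrable setT (EFin \o (fun w => \sum_(i < n) f i w)).
Proof.
move=> fi; rewrite (_ : _ \o _ = (fun w => \sum_(i < n) (f i w)%:E)%E).
  by apply: integrable_sum => // i _; exact: fi.
by apply/funext => w /=; rewrite sumEFin.
Qed.

Lemma integrable_measurable (f : W -> R) :
  mu.-integrable setT (EFin \o f) -> measurable_fun setT f.
Proof. by move=> /measurable_int/measurable_EFinP. Qed.

Lemma integrable_minr (f g : W -> R) : mu.-integrable setT (EFin \o f) ->
  mu.-integrable setT (EFin \o g) ->
  mu.-integrable setT (EFin \o (fun w => Num.min (f w) (g w))).
Proof.
move=> fi gi; apply: (@integrable_dominated _ (fun w => `|f w| + `|g w|)).
- by apply: measurable_minr; exact: integrable_measurable.
- by apply: integrableD_EFin; exact: integrable_norm.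
- by move=> w; case: (leP (f w) (g w)) => _; rewrite ?lerDl ?lerDr.
Qed.

Lemma integrable_maxr (f g : W -> R) : mu.-integrable setT (EFin \o f) ->
  mu.-integrable setT (EFin \o g) ->
  mu.-integrable setT (EFin \o (fun w => Num.max (f w) (g w))).
Proof.
move=> fi gi; apply: (@integrable_dominated _ (fun w => `|f w| + `|g w|)).
- by apply: measurable_maxr; exact: integrable_measurable.
- by apply: integrableD_EFin; exact: integrable_norm.
- by move=> w; case: (leP (f w) (g w)) => _; rewrite ?lerDl ?lerDr.
Qed.

Lemma integrable_bigmaxr (I : Type) (s : seq I) (f0 : W -> R)
    (f : I -> W -> R) :
  mu.-integrable setT (EFin \o f0) ->
  (forall i, mu.-integrable setT (EFin \o f i)) ->
  mu.-integrable setT (EFin \o (fun w => \big[Num.max/f0 w]_(i <- s) f i w)).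
Proof.
move=> f0i fi; elim: s => [|i s IH].
  by rewrite (_ : _ \o _ = EFin \o f0)//; apply/funext => w /=; rewrite big_nil.
rewrite (_ : _ \o _ = EFin \o
    (fun w => Num.max (f i w) (\big[Num.max/f0 w]_(j <- s) f j w))).
  exact: integrable_maxr.
by apply/funext => w /=; rewrite big_cons.
Qed.

Lemma bool_indicE (b : W -> bool) :
  (fun w => (b w)%:R) = \1_[set w | b w] :> (W -> R).
Proof.
apply/funext => w; rewrite indicE; congr (_%:R)%R; congr nat_of_bool.
by apply/idP/idP; rewrite inE.
Qed.

Lemma integrable_boolM (b : W -> bool) (f : W -> R) :
  measurable [set w | b w] -> mu.-integrable setT (EFin \o f) ->
  mu.-integrable setT (EFin \o (fun w => (b w)%:R * f w)).
Proof.
move=> mb fi; apply: (@integrable_dominated _ (fun w => `|f w|)).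
- apply: measurable_funM; last exact: integrable_measurable.
  by rewrite bool_indicE; exact: measurable_indic.
- exact: integrable_norm.
- by move=> w; case: (b w); rewrite ?mul1r ?mul0r ?normr0.
Qed.

Lemma expectation_Rintegral (f : W -> R) : mu.-integrable setT (EFin \o f) ->
  'E_mu[f]%E = (\int[mu]_w f w)%:E.
Proof. by move=> fi; rewrite unlock fineK//; exact: integrable_fin_num. Qed.

Lemma Rintegral_cst_probability (k : R) : \int[mu]_w k = k.
Proof.
rewrite Rintegral_cst//; have -> : fine (mu setT) = 1 :> R; last exact: mulr1.
by rewrite [X in fine X]probability_setT.
Qed.

End real_integrals.

Section index_equation.
Import numFieldNormedType.Exports.
Context d (T : measurableType d) (R : realType) (P : probability T R).
Variables (alpha c t : R) (X : T -> R).
Hypotheses (alpha_gt0 : 0 < alpha) (c_gt0 : 0 < c).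
Hypothesis Xi : P.-integrable setT (EFin \o X).

Let Y w := alpha^-1 * Num.min t (X w).

Lemma integrable_capped : P.-integrable setT (EFin \o Y).
Proof.
apply: integrableZl_EFin; apply: integrable_minr => //.
exact: integrable_cst_EFin.
Qed.

Lemma integrable_excess s :
  P.-integrable setT (EFin \o (fun w => Num.max (Y w - s) 0)).
Proof.
apply: integrable_maxr; last exact: integrable_cst_EFin.
apply: integrableB_EFin; [exact: integrable_capped|exact: integrable_cst_EFin].
Qed.

Let f s := \int[P]_w Num.max (Y w - s) 0.

Let f_lip s s' : f s - f s' <= `|s - s'|.
Proof.
rewrite /f -RintegralB//; [|exact: integrable_excess..].
rewrite -[leRHS](Rintegral_cst_probability P).
apply: le_Rintegral => //.
- by apply: integrableB_EFin; exact: integrable_excess.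
- exact: integrable_cst_EFin.
- move=> w _; rewrite lerBlDr ge_max; apply/andP; split.
    have := ler_norm (s' - s); rewrite distrC => h.
    have : Y w - s' <= Num.max (Y w - s') 0 by rewrite le_max lexx.
    by lra.
  by rewrite addr_ge0// le_max lexx orbT.
Qed.

Lemma sigmaP :
  ('E_P[fun w => Num.max (Y w - sigma P alpha X c t)%R 0%R])%E = c%:E.
Proof.
apply: (xgetPex 0
  (P := fun s => ('E_P[fun w => Num.max (Y w - s)%R 0%R])%E = c%:E)).
(* At [a] already the mean of [Y - a] equals [c], so the excess has mean at least [c]. Above
   [alpha^-1 * t] the excess vanishes; the maximum in [b] ensures [a <= b]. *)
pose a := \int[P]_w Y w - c.
pose b := Num.max a (alpha^-1 * t).
have fa : c <= f a.
  have -> : c = \int[P]_w (Y w - a).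
    rewrite RintegralB//;
      [|exact: integrable_capped|exact: integrable_cst_EFin].
    by rewrite Rintegral_cst_probability /a subKr.
  apply: le_Rintegral => //; [|exact: integrable_excess|].
    apply: integrableB_EFin;
      [exact: integrable_capped|exact: integrable_cst_EFin].
  by move=> w _; rewrite le_max lexx.
have fb : f b = 0.
  rewrite /f -[RHS](Rintegral_cst_probability P); apply: eq_Rintegral => w _.
  apply: max_r; rewrite subr_le0 le_max; apply/orP; right.
  by apply: ler_wpM2l; [rewrite invr_ge0 ltW|rewrite ge_min lexx].
have cf : continuous f.
  move=> s; apply/cvgrPdist_le => e e0; near=> s'.
  have se : `|s - s'| <= e by near: s'; exact: cvgr_dist_le.
  rewrite ler_norml; apply/andP; split.
    by rewrite lerNl opprB (le_trans (f_lip _ _))// distrC.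
  exact: le_trans (f_lip _ _) se.
have [|||s _ fs] := @IVT _ f a b c.
- by rewrite le_max lexx.
- exact: continuous_subspaceT.
- by rewrite fb ge_min (ltW c_gt0) orbT le_max fa.
exists s; rewrite expectation_Rintegral; first by rewrite -fs.
exact: integrable_excess.
Unshelve. all: by end_near.
Qed.

End index_equation.

(** * Bounds on the objective *)

Section objective_bounds.
Context d d' (U : measurableType d) (T : measurableType d') (R : realType).
Variables (Q : probability U R) (P : probability T R).
Variables (alpha : R) (n : nat) (X : 'I_n.+1 -> {RV P >-> R}).
Variables (c : 'I_n.+1 -> R) (pi : policy R n.+1 U).
Hypotheses (alpha_gt0 : 0 < alpha) (c_gt0 : forall i, 0 < c i).
Hypothesis Xi : forall i, P.-integrable setT (EFin \o X i).
Hypothesis indep : mutually_independent P (fun i => X i : T -> R).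

Let mu : probability (U * T)%type R := (Q \x P)%E.
Let opn (p : U * T) i := is_opened (pi p.1) (X ^~ p.2) i.
Let sel (p : U * T) i := is_selected (pi p.1) (X ^~ p.2) i.
Let Z : U * T -> R := payoff (fun i => X i : T -> R) pi.
Let cost : U * T -> R := inspection_cost (fun i => X i : T -> R) c pi.
Let sg t i := sigma P alpha (X i) (c i) t.
Let v t i w := alpha^-1 * Num.min t (X i w).
Let excess t i w := Num.max (v t i w - sg t i) 0.
Let kap t w := \big[Num.max/kappa P alpha (X ord0) (c ord0) t w]_(i < n.+1)
  kappa P alpha (X i) (c i) t w.

Lemma integrable_payoff : mu.-integrable setT (EFin \o Z).
Proof.
apply: (@integrable_sum_EFin _ _ _ mu n.+1
  (fun i p => (sel p i)%:R * X i p.2)) => i.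
apply: integrable_boolM; first exact: measurable_selected_set.
exact: integrable_snd.
Qed.

Lemma integrable_inspection_cost : mu.-integrable setT (EFin \o cost).
Proof.
apply: (@integrable_sum_EFin _ _ _ mu n.+1
  (fun i p => (opn p i)%:R * c i)) => i.
apply: integrable_boolM; first exact: measurable_opened_set.
exact: integrable_cst_EFin.
Qed.

Lemma integrable_kappa t i :
  P.-integrable setT (EFin \o kappa P alpha (X i) (c i) t).
Proof.
apply: (@integrable_minr _ _ _ P (v t i)); first exact: integrable_capped.
exact: integrable_cst_EFin.
Qed.

Lemma integrable_max_kappa t : P.-integrable setT (EFin \o kap t).
Proof. by apply: integrable_bigmaxr => [|i]; exact: integrable_kappa. Qed.

Let surplus t p := \sum_(i < n.+1) (opn p i)%:R * excess t i p.2.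

Lemma integrable_surplus t : mu.-integrable setT (EFin \o surplus t).
Proof.
apply: (@integrable_sum_EFin _ _ _ mu n.+1
  (fun i p => (opn p i)%:R * excess t i p.2)) => i.
apply: integrable_boolM; first exact: measurable_opened_set.
by apply: integrable_snd; exact: integrable_excess.
Qed.

(* The opening decision is independent of the prize, and c_i is the expected
   excess of box i, so costs and collected excesses agree on average. *)
Lemma expected_cost_surplus t : \int[mu]_p cost p = \int[mu]_p surplus t p.
Proof.
rewrite /Rintegral; congr fine.
have mb i : measurable_fun setT (fun p => (opn p i)%:R : R).
  by rewrite bool_indicE; apply: measurable_indic; exact: measurable_opened_set.
have me i : measurable_fun setT (excess t i).
  exact/(@integrable_measurable _ _ _ P)/integrable_excess.
have e0 i w : 0 <= excess t i w by rewrite /excess le_max lexx orbT.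
transitivity (\sum_(i < n.+1) \int[mu]_p ((opn p i)%:R * c i)%:E)%E.
  rewrite -ge0_integral_sum//.
  - by apply: eq_integral => p _; rewrite sumEFin.
  - by move=> i; apply/measurable_EFinP; exact: measurable_funM.
  - by move=> i p _; rewrite lee_fin mulr_ge0// ltW.
transitivity (\sum_(i < n.+1) \int[mu]_p ((opn p i)%:R * excess t i p.2)%:E)%E;
    last first.
  rewrite -ge0_integral_sum//.
  - by apply: eq_integral => p _; rewrite sumEFin.
  - move=> i; apply/measurable_EFinP; apply: measurable_funM => //.
    exact: (measurableT_comp (me i) measurable_snd).
  - by move=> i p _; rewrite lee_fin mulr_ge0.
apply: eq_bigr => i _.
have mD : measurable [set p | opn p i] by exact: measurable_opened_set.
(* Turns the opening indicator into a domain of integration, as [ge0_integral_indep] requires. *)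
have boolE (g : U * T -> R) : (\int[mu]_p ((opn p i)%:R * g p)%:E =
    \int[mu]_(p in [set p | opn p i]) (g p)%:E)%E.
  rewrite [RHS]integral_mkcond; apply: eq_integral => p _.
  rewrite patchE; case: ifPn => /=.
    by rewrite inE /= => ->; rewrite mul1r.
  by rewrite notin_setE /= => /negP/negbTE ->; rewrite mul0r.
rewrite !boolE.
pose g x := Num.max (alpha^-1 * Num.min t x - sg t i) 0.
have mg : measurable_fun [set: R] g.
  apply: measurable_maxr => //; apply: measurable_funB => //.
  by apply: measurable_funM => //; exact: measurable_minr.
rewrite (@ge0_integral_indep _ _ _ _ _ mu P _ (X i \o snd) (X i) g)//.
- rewrite integral_cst// muleC; congr (_ * _)%E.
  have := @sigmaP _ _ _ P alpha (c i) t (X i) alpha_gt0 (c_gt0 i) (Xi i).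
  by rewrite unlock => ->.
- exact: (measurableT_comp (measurable_funPT _) measurable_snd).
- by move=> r; rewrite /g le_max lexx orbT.
- by move=> A mA; exact: opened_indep_prize.
Qed.

Let term t : \bar R :=
  (t%:E - (alpha^-1)%:E * 'E_mu[fun p => Num.max (t - Z p)%R 0%R])%E.

(** Uses [t - Num.max (t - Z) 0 = Num.min t Z]. The surplus is subtracted and the cost added, which
    cancel in mean, so that the integrand is the one bounded by amortization. *)
Lemma termE t : term t =
  (\int[mu]_p (alpha^-1 * Num.min t (Z p) - surplus t p) +
   \int[mu]_p cost p - (1 - alpha) / alpha * t)%:E.
Proof.
have iZ := integrable_payoff.
have i1 : mu.-integrable setT (EFin \o (fun p => alpha^-1 * Num.min t (Z p))).
  apply: integrableZl_EFin; apply: integrable_minr => //.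
  exact: integrable_cst_EFin.
have i2 : mu.-integrable setT (EFin \o (fun p => Num.max (t - Z p) 0)).
  apply: integrable_maxr; last exact: integrable_cst_EFin.
  by apply: integrableB_EFin => //; exact: integrable_cst_EFin.
rewrite /term expectation_Rintegral// RintegralB//; last first.
  exact: integrable_surplus.
rewrite -expected_cost_surplus subrK -EFinM -EFinB; congr EFin.
have -> : \int[mu]_p (alpha^-1 * Num.min t (Z p)) =
    \int[mu]_p (alpha^-1 * t - alpha^-1 * Num.max (t - Z p) 0).
  by apply: eq_Rintegral => p _; rewrite -mulrBr subr_excess.
rewrite RintegralB//; [|exact: integrable_cst_EFin|exact: integrableZl_EFin].
rewrite Rintegral_cst_probability RintegralZl//.
by field; rewrite gt_eqF.
Qed.

Lemma kappa_valueE t : kappa_value P alpha (fun i => X i : T -> R) c t =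
  (\int[mu]_p kap t p.2 - (1 - alpha) / alpha * t)%:E.
Proof.
rewrite /kappa_value expectation_Rintegral; last exact: integrable_max_kappa.
by rewrite Rintegral_snd//; exact: integrable_max_kappa.
Qed.

Let integrable_amortized t : mu.-integrable setT
  (EFin \o (fun p => alpha^-1 * Num.min t (Z p) - surplus t p)).
Proof.
apply: integrableB_EFin; last exact: integrable_surplus.
apply: integrableZl_EFin; apply: integrable_minr.
  exact: integrable_cst_EFin.
exact: integrable_payoff.
Qed.

(** After the expected cost cancels, each term of the CVaR supremum is bounded by the kappa value at
    the same [t], through the pointwise bound [amortized_le]. *)
Lemma objective_le (V : R) :
  (forall t, kappa_value P alpha (fun i => X i : T -> R) c t <= V%:E)%E ->
  (objective alpha P (fun i => X i : T -> R) c Q pi <= V%:E)%E.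
Proof.
move=> hV; rewrite /objective -/cost expectation_Rintegral; last first.
  exact: integrable_inspection_cost.
rewrite leeBlDr//; apply: ge_ereal_sup => _ [t _ <-].
rewrite -/(term t) termE -EFinD lee_fin addrAC lerD2r.
rewrite -lee_fin (le_trans _ (hV t))// kappa_valueE lee_fin lerD2r.
apply: le_Rintegral => //.
  by apply: integrable_snd; exact: integrable_max_kappa.
move=> p _.
have [j hj] :=
  amortized_le alpha t (sg t) (X ^~ p.2) (policy_legal pi p.1).
apply: le_trans hj _.
exact: (le_bigmax _ (fun i => kappa P alpha (X i) (c i) t p.2)).
Qed.

(** The CVaR is at least its term at this [t], for which [amortized_index] gives the reverse
    pointwise bound. *)
Lemma objective_ge t : is_index_policy alpha (sg t) t pi ->
  (kappa_value P alpha (fun i => X i : T -> R) c t <=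
   objective alpha P (fun i => X i : T -> R) c Q pi)%E.
Proof.
move=> ipi; rewrite /objective -/cost expectation_Rintegral; last first.
  exact: integrable_inspection_cost.
rewrite leeBrDr//; apply: le_trans (ereal_sup_ubound _); last by exists t.
rewrite -/(term t) termE kappa_valueE -EFinD lee_fin addrAC lerD2r lerD2r.
apply: le_Rintegral => //.
  by apply: integrable_snd; exact: integrable_max_kappa.
move=> p _; have h := amortized_index (X ^~ p.2) alpha_gt0
  (policy_legal pi p.1) (ipi p.1).
by apply: bigmax_le => [|i _]; exact: h.
Qed.

End objective_bounds.

(** * Existence of an index policy *)

Section index_policy_exists.
Context {R : realType} {n : nat}.
Variables (alpha t : R) (idx : 'I_n.+1 -> R).

Definition best_unopened (s : seq 'I_n.+1) : 'I_n.+1 :=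
  xget ord0 [set i | i \notin s /\ forall j, j \notin s -> idx j <= idx i].

(** Ties are broken by [xget], hence as a function of the set of candidates alone, which keeps the
    decision measurable. *)
Definition index_decision (h : @history R n.+1) : @action n.+1 :=
  if pselect (stop_condition alpha idx t h)
  then Select (xget ord0 [set j | exists r, best_observed h j r])
  else Open (best_unopened (opened h)).

Lemma best_unopenedP s i0 : i0 \notin s -> best_unopened s \notin s /\
  forall j, j \notin s -> idx j <= idx (best_unopened s).
Proof.
move=> i0s.
apply: (xgetPex ord0
  (P := fun i => i \notin s /\ forall j, j \notin s -> idx j <= idx i)).
exists [arg max_(i > i0 | i \notin s) idx i]%O.
by case: (@Order.TotalTheory.arg_maxP _ _ _ i0
  (fun i => i \notin s) idx i0s) => i.
Qed.

Lemma index_decisionP h :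
  match index_decision h with
  | Open i => ~ stop_condition alpha idx t h /\ i \notin opened h /\
      (forall j, j \notin opened h -> idx j <= idx i)
  | Select j => stop_condition alpha idx t h /\ exists r, best_observed h j r
  end.
Proof.
rewrite /index_decision; case: pselect => [st|nst] /=; split=> //.
  apply: (xgetPex ord0 (P := fun j => exists r, best_observed h j r)).
  by have [j [r [br _]]] := st; exists j, r.
have [[i0 i0s]|allo] := pselect (exists i0, i0 \notin opened h).
  exact: best_unopenedP i0s.
(* Once every box is opened, the history is nonempty since there are [n.+1] boxes, and the condition
   on the remaining indices is vacuous: the rule must stop. *)
case: nst; have [|j [r br]] := @best_observed_ex R n.+1 h.
  by apply: contra_notN allo => /eqP ->; exists ord0.
by exists j, r; split=> // k kh; exfalso; apply: allo; exists k.
Qed.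

Lemma index_decision_legal : legal index_decision.
Proof.
move=> h; have := index_decisionP h.
case: (index_decision h) => [i [_ []]//|j [_ [r [jr _]]]].
by apply/mapP; exists (j, r).
Qed.

(** Measurability of a policy is required for every [s], even with repeated boxes, so observations
    are addressed by position. *)
Lemma mem_zip_tnth (s : seq 'I_n.+1) (x : (size s).-tuple R) j r :
  (j, r) \in zip s x <->
  exists i, j = tnth (in_tuple s) i /\ r = tnth x i.
Proof.
split=> [/(tnthP [tuple of zip (in_tuple s) x])[i ji]|[i [-> ->]]].
  exists i; move: ji; rewrite (tnth_nth (ord0, 0)) /= nth_zip ?size_tuple//.
  by move=> [-> ->]; rewrite (tnth_nth ord0) (tnth_nth 0).
rewrite (tnth_nth ord0) (tnth_nth 0) /= -nth_zip ?size_tuple//.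
by rewrite mem_nth// size_zip size_tuple minnn.
Qed.

(** Being the best observation amounts to finitely many comparisons of coordinates. [Phi] covers
    both the stopping inequalities and the identity of the best box. *)
Lemma measurable_best_observed (s : seq 'I_n.+1) (Phi : 'I_n.+1 -> R -> Prop) :
  (forall j, measurable [set r | Phi j r]) ->
  measurable [set x : (size s).-tuple R |
    exists j r, best_observed (zip s x) j r /\ Phi j r].
Proof.
move=> mPhi.
have mle (i k : 'I_(size s)) :
    measurable [set x : (size s).-tuple R | tnth x k <= tnth x i].
  have := @measurable_fun_ler _ _ R setT _ _
    (measurable_tnth k) (measurable_tnth i).
  by move=> /(_ measurableT [set true] I); rewrite setTI.
rewrite [X in measurable X](_ : _ = \bigcup_(i in [set: 'I_(size s)])
    ((\bigcap_(k in [set: 'I_(size s)]) [set x | tnth x k <= tnth x i]) `&`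
     (@tnth _ R ^~ i) @^-1` [set r | Phi (tnth (in_tuple s) i) r])).
  apply: fin_bigcup_measurable; first exact: finite_finset.
  move=> i _; apply: measurableI.
    by apply: fin_bigcap_measurable; first exact: finite_finset.
  by rewrite -[X in measurable X]setTI; exact: measurable_tnth.
apply/seteqP; split=> x /=.
  move=> [j [r [[/mem_zip_tnth[i [-> ->]] br] Pj]]]; exists i => //.
  split=> // k _ /=.
  by apply: (br (tnth (in_tuple s) k)); apply/mem_zip_tnth; exists k.
move=> [i _ [br Pi]]; exists (tnth (in_tuple s) i), (tnth x i); split=> //.
split; first by apply/mem_zip_tnth; exists i.
by move=> j r /mem_zip_tnth[k [_ ->]]; exact: br.
Qed.

(* A choice depending only on a measurable random subset of a finite type is
   measurable, because there are finitely many subsets. *)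
Lemma measurable_finite_choice d (W : measurableType d) (I : finType)
    (S : W -> set I) (F : set I -> Prop) :
  (forall k, measurable [set w | S w k]) -> measurable [set w | F (S w)].
Proof.
move=> mS.
rewrite [X in measurable X](_ : _ =
    \bigcup_(A in [set A : {set I} | F [set` A]])
    \bigcap_(k in [set: I]) [set w | S w k <-> k \in A]).
  apply: fin_bigcup_measurable; first exact: finite_finset.
  move=> A _; apply: fin_bigcap_measurable; first exact: finite_finset.
  move=> k _; case: (boolP (k \in A)) => kA.
    rewrite [X in measurable X](_ : _ = [set w | S w k])//.
    by apply/seteqP; split=> w /=; [move=> [_]; exact|move=> ?; split].
  rewrite [X in measurable X](_ : _ = ~` [set w | S w k]).
    exact: measurableC.
  by apply/seteqP; split=> w /=; [move=> [h _] /h|move=> h; split].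
apply/seteqP; split=> w /=.
  move=> FS; exists [set k | `[< S w k >]]%SET => /=.
    rewrite (_ : [set` _] = S w)//; apply/seteqP; split=> k /=; rewrite inE.
      by move/asboolP.
    by move=> ?; apply/asboolP.
  by move=> k _ /=; rewrite inE; split=> /asboolP.
move=> [A FA h]; rewrite (_ : S w = [set` A])//.
by apply/seteqP; split=> k /=; have := h k Logic.I => /=; tauto.
Qed.

(** For fixed [s] the box to open is a constant; the prizes enter only through the stop condition
    and the set of best boxes. *)
Lemma index_decision_measurable (s : seq 'I_n.+1) (a : @action n.+1) :
  measurable [set p : unit * (size s).-tuple R |
    index_decision (zip s p.2) = a].
Proof.
suff m : measurable [set x : (size s).-tuple R | index_decision (zip s x) = a].
  have := @measurable_snd _ _ unit ((size s).-tuple R) measurableT _ m.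
  by rewrite setTI.
have op (x : (size s).-tuple R) : opened (zip s x) = s.
  by rewrite /opened unzip1_zip ?size_tuple.
have mstop : measurable [set x : (size s).-tuple R |
    stop_condition alpha idx t (zip s x)].
  rewrite [X in measurable X](_ : _ = [set x : (size s).-tuple R |
      exists j r, best_observed (zip s x) j r /\
        forall k, k \notin s -> idx k < alpha^-1 * Num.min t r]).
    apply: (measurable_best_observed (Phi := fun _ r => forall k, k \notin s ->
      idx k < alpha^-1 * Num.min t r)) => _.
    rewrite [X in measurable X](_ : _ = \bigcap_(k in [set k | k \notin s])
        [set r : R | idx k < alpha^-1 * Num.min t r]); last first.
      by apply/seteqP; split=> r /= h k; exact: h.
    apply: fin_bigcap_measurable; first exact: finite_finset.
    move=> k _.
    have mm : measurable_fun [set: R] (fun r : R => alpha^-1 * Num.min t r).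
      by apply: measurable_funM => //; exact: measurable_minr.
    have := measurable_fun_ltr (measurable_cst (idx k)) mm.
    by move=> /(_ measurableT [set true] I); rewrite setTI.
  by apply: eq_set => x; rewrite /stop_condition op.
case: a => [i|j].
  rewrite [X in measurable X](_ : _ = ~` [set x : (size s).-tuple R |
      stop_condition alpha idx t (zip s x)] `&` [set _ | best_unopened s = i]).
    apply: measurableI; [exact: measurableC|exact: measurable_constant_set].
  apply/seteqP; split=> x /=; rewrite /index_decision; case: pselect => //=.
  - by move=> nst [<-]; rewrite op.
  - by move=> st [].
  - by move=> _ [_ <-]; rewrite op.
rewrite [X in measurable X](_ : _ = [set x : (size s).-tuple R |
    stop_condition alpha idx t (zip s x)] `&` [set x : (size s).-tuple R |
    xget ord0 [set j | exists r, best_observed (zip s x) j r] = j]).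
  apply: measurableI => //.
  apply: (measurable_finite_choice (fun B => xget ord0 B = j)) => k /=.
  rewrite [X in measurable X](_ : _ = [set x : (size s).-tuple R |
    exists j r, best_observed (zip s x) j r /\ j = k]).
    apply: measurable_best_observed => l; exact: measurable_constant_set.
  apply/seteqP; split=> x /=; first by move=> [r br]; exists k, r.
  by move=> [l [r [br <-]]]; exists r.
apply/seteqP; split=> x /=; rewrite /index_decision; case: pselect => //=.
- by move=> st [<-].
- by move=> st [_ <-].
- by move=> nst [].
Qed.

Definition index_policy : policy R n.+1 unit :=
  @Policy R n.+1 _ unit (fun=> index_decision)
    (fun=> index_decision_legal) index_decision_measurable.

Lemma index_policyP : is_index_policy alpha idx t index_policy.
Proof. by move=> u h; exact: index_decisionP. Qed.

End index_policy_exists.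

(** * Optimality of the index policy *)

Theorem theorem1 (R : realType) (d : measure_display) (T : measurableType d)
    (P : probability T R) (alpha : R) (n : nat)
    (X : 'I_n.+1 -> {RV P >-> R}) (c : 'I_n.+1 -> R) (tstar : R)
    (alpha_gt0 : 0 < alpha) (alpha_lt1 : alpha < 1)
    (X_integrable : forall i, P.-integrable setT (EFin \o X i))
    (X_independent : mutually_independent P (fun i => X i : T -> R))
    (c_gt0 : forall i, 0 < c i)
    (tstar_max : forall t : R,
      (kappa_value P alpha (fun i => X i : T -> R) c t
       <= kappa_value P alpha (fun i => X i : T -> R) c tstar)%E) :
  let idx := fun i => sigma P alpha (X i) (c i) tstar in
  (exists pi : policy R n.+1 unit, is_index_policy alpha idx tstar pi) /\
  (forall (d1 : measure_display) (U : measurableType d1) (Q : probability U R)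
      (pi : policy R n.+1 U),
    is_index_policy alpha idx tstar pi ->
    forall (d2 : measure_display) (V : measurableType d2)
        (Q' : probability V R) (pi' : policy R n.+1 V),
      (objective alpha P (fun i => X i : T -> R) c Q' pi'
       <= objective alpha P (fun i => X i : T -> R) c Q pi)%E).
Proof.
move=> idx; split.
  by exists (index_policy alpha tstar idx); exact: index_policyP.
move=> d1 U Q pi ipi d2 V Q' pi'.
apply: le_trans (objective_ge Q alpha_gt0 c_gt0 X_integrable X_independent ipi).
(* The kappa value at [tstar] separates the two objectives; written as a real number, it can serve
   as the bound in [objective_le]. *)
rewrite (kappa_valueE Q alpha c X_integrable tstar).
apply: objective_le => // t.
by rewrite -(kappa_valueE Q alpha c X_integrable tstar).
Qed.
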